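(* Let $A_1,\dots,A_n$ be sets and let $S\subset A_1\times\cdots\times A_n$ be finite and nonempty. (1) Let $\pi$ be any fixed permutation of $\{1,\dots,n\}$ and choose $s\in S$ uniformly at random. Then $$\log|S|\le E_s\left[\sum_{i=1}^n \log X_i(s,\pi)\right].$$ (2) If $\pi$ is chosen at random from the permutations of $\{1,\dots,n\}$ according to an arbitrary probability distribution, and $s\in S$ is chosen uniformly at random independently of $\pi$, then $$\log|S|\le E_{(s,\pi)}\left[\sum_{i=1}^n \log X_i(s,\pi)\right]\le \sum_{i=1}^n \max_{s\in S} E_\pi\left[\log X_i(s,\pi)\right].$$
   Context: All logarithms are natural. For $s=(s_1,\dots,s_n)\in S$, a permutation $\pi$ of $\{1,\dots,n\}$ and $1\le i\le n$, define $$X_i(s,\pi)=\left|\{x_i : (x_1,\dots,x_n)\in S,\ x_j=s_j \text{ for all } j \text{ satisfying } \pi^{-1}(j)<\pi^{-1}(i)\}\right|.$$ That is, the components of $s$ are revealed in the order $s_{\pi(1)},s_{\pi(2)},\dots,s_{\pi(n)}$, and $X_i(s,\pi)$ is the number of possible values of the $i$th component, over members of $S$ agreeing with $s$ on all components revealed before the $i$th. $E_r[\cdot]$ denotes expectation over the random variable $r$; in $E_\pi$ the element $s$ is fixed. *)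

(* Defs.v *)
From mathcomp Require Import all_boot all_order all_algebra all_fingroup.
From mathcomp Require Import finmap.
From mathcomp Require Import reals exp.

Set Implicit Arguments.
Unset Strict Implicit.
Unset Printing Implicit Defensive.

Import Order.TTheory GRing.Theory Num.Theory.
Local Open Scope ring_scope.
Local Open Scope fset_scope.

Section FiniteProbability.
Variable R : realType.

Definition is_distr (T : finType) (p : T -> R) : Prop :=
  (forall t, 0 <= p t) /\ \sum_t p t = 1.

Definition uniform (T : finType) : T -> R := fun=> #|T|%:R^-1.

(* The joint law of two independent random variables with laws p and q. *)
Definition indep (T U : finType) (p : T -> R) (q : U -> R) : T * U -> R :=
  fun z => p z.1 * q z.2.

Definition expect (T : finType) (p : T -> R) (f : T -> R) : R :=
  \sum_t p t * f t.

(* The value is a genuine maximum as soon as T is inhabited: the big maximum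
   starts from a value of f, not from 0. *)
Definition maxval (T : finType) (f : T -> R) : R :=
  if [pick t : T] is Some t0 then \big[Num.max/f t0]_t f t else 0.

End FiniteProbability.

Section RevealingOrder.
Variables (n : nat) (A : 'I_n -> choiceType).
Variable S : {fset {dffun forall i : 'I_n, A i}}.
Implicit Types (i : 'I_n) (s : {dffun forall i : 'I_n, A i}) (pi : 'S_n).

(* Components are revealed in the order s (pi 0), s (pi 1), ..., so component j
   is revealed before component i when pi^-1 j < pi^-1 i. *)
Definition agreeing i s pi : {fset {dffun forall i : 'I_n, A i}} :=
  [fset x in S | [forall j : 'I_n,
     ((pi^-1)%g j < (pi^-1)%g i)%N ==> (x j == s j)]].

Definition nvalues i s pi : nat :=
  #|` [fset (x : {dffun forall i : 'I_n, A i}) i | x in agreeing i s pi]|.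

End RevealingOrder.

(* Main.v *)
Require Import Defs.
From mathcomp Require Import all_boot all_order all_algebra all_fingroup.
From mathcomp Require Import finmap.
From mathcomp Require Import reals exp.

Set Implicit Arguments.
Unset Strict Implicit.
Unset Printing Implicit Defensive.

Import Order.TTheory GRing.Theory Num.Theory.
Local Open Scope ring_scope.
Local Open Scope fset_scope.

(** Reveal the components of a member of S in the order pi, drawing each one
    uniformly among the values still possible given the earlier ones. This
    sequential procedure ends at s with probability
    q(s) = \prod_i 1 / X_i(s, pi), and it always ends in S, so q is a
    probability distribution on S ([kraft_nvalues]). By Gibbs' inequality the
    cross entropy of the uniform law on S relative to q is at least the entropy
    ln |S| of the uniform law ([gibbs_uniform]); since
    - ln q(s) = \sum_i ln X_i(s, pi), this is the first claim.

    For a random pi, the expectation over (s, pi) is an average over pi of the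
    quantities bounded in the first claim, whence the lower bound. Summing over
    i first and pi innermost, it is also the sum over i of averages over s of
    E_pi [ln X_i(s, pi)], and an average is at most a maximum. *)

(** * Expectations *)

Section Expectation.
Variable R : realType.
Implicit Types T U : finType.

Lemma uniform_distr T (t0 : T) : is_distr (@uniform R T).
Proof.
split=> [t|]; first by rewrite invr_ge0 ler0n.
have cardT : (#|T|%:R : R) != 0.
  by rewrite pnatr_eq0 -lt0n; apply/card_gt0P; exists t0.
by rewrite sumr_const -[_ *+ _]mulr_natr mulVf.
Qed.

Lemma expect_cst T (p : T -> R) c : is_distr p -> expect p (fun=> c) = c.
Proof. by case=> _ p1; rewrite /expect -mulr_suml p1 mul1r. Qed.

Lemma ler_expect T (p f g : T -> R) :
  is_distr p -> (forall t, f t <= g t) -> expect p f <= expect p g.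
Proof. by move=> [p0 _] fg; apply: ler_sum => t _; rewrite ler_wpM2l. Qed.

Lemma expect_sum T (I : finType) (p : T -> R) (f : I -> T -> R) :
  expect p (fun t => \sum_i f i t) = \sum_i expect p (f i).
Proof.
by rewrite exchange_big; apply: eq_bigr => t _; rewrite mulr_sumr.
Qed.

Lemma expect_indep T U (p : T -> R) (q : U -> R) (f : T -> U -> R) :
  expect (indep p q) (fun z => f z.1 z.2)
    = expect p (fun t => expect q (f t)).
Proof.
rewrite /expect -(pair_bigA _ (fun t u => p t * q u * f t u)).
apply: eq_bigr => t _; rewrite mulr_sumr.
by apply: eq_bigr => u _; rewrite mulrA.
Qed.

Lemma expect_exchange T U (p : T -> R) (q : U -> R) (f : T -> U -> R) :
  expect p (fun t => expect q (f t))
    = expect q (fun u => expect p (f^~ u)).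
Proof.
rewrite /expect; under eq_bigr do rewrite mulr_sumr.
rewrite exchange_big; apply: eq_bigr => u _; rewrite mulr_sumr.
by apply: eq_bigr => t _; rewrite mulrCA.
Qed.

Lemma ler_maxval T (f : T -> R) t : f t <= maxval f.
Proof.
by rewrite /maxval; case: pickP => [t0 _|/(_ t)//]; apply: le_bigmax.
Qed.

Lemma ler_expect_maxval T (p f : T -> R) : is_distr p -> expect p f <= maxval f.
Proof.
move=> pd; rewrite -[leRHS](expect_cst _ pd); apply: ler_expect => // t.
exact: ler_maxval.
Qed.

Lemma ln_prodV (I : finType) (f : I -> R) :
  (forall i, 0 < f i) -> - ln (\prod_i (f i)^-1) = \sum_i ln (f i).
Proof.
move=> f0.
(* lnM needs positive factors, so the induction carries positivity along. *)
suff [] : 0 < \prod_i (f i)^-1 /\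
  - ln (\prod_i (f i)^-1) = \sum_i ln (f i) by [].
elim/big_rec2: _ => [|i x y _ [y0 IH]]; first by rewrite ln1 oppr0.
have fi0 : 0 < (f i)^-1 by rewrite invr_gt0.
by rewrite mulr_gt0 // lnM ?posrE // lnV ?posrE // opprD opprK IH.
Qed.

(** Gibbs' inequality against the uniform law: average the tangent line bound
    ln (#|T| q t) <= #|T| q t - 1 over t. The right-hand side averages to
    \sum_t q t - 1 <= 0, so a subprobability q is enough. *)
Lemma gibbs_uniform T (t0 : T) (q : T -> R) :
  (forall t, 0 < q t) -> \sum_t q t <= 1 ->
  ln #|T|%:R <= expect (@uniform R T) (fun t => - ln (q t)).
Proof.
move=> q0 q1; have ud := uniform_distr t0.
have N0 : 0 < #|T|%:R :> R by rewrite ltr0n; apply/card_gt0P; exists t0.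
have Nq : expect (@uniform R T) (fun t => #|T|%:R * q t) = \sum_t q t.
  by apply: eq_bigr => t _; rewrite mulKf ?gt_eqF.
have ineq t : (ln #|T|%:R + 1 <= - ln (q t) + #|T|%:R * q t)%R.
  rewrite [leRHS]addrC lerBrDr addrAC -lnM ?posrE // -lerBrDr.
  rewrite -{1}[_ * q t](subrK 1) [X in ln X]addrC le_ln1Dx //.
  by rewrite ltrBrDl subrr mulr_gt0.
have := ler_expect ud ineq; rewrite expect_cst //.
rewrite [leRHS](_ : _ =
    (expect (@uniform R T) (fun t => - ln (q t)) + \sum_t q t)%R).
  by move=> h; rewrite -(lerD2r 1); apply: le_trans h _; rewrite lerD2l.
by rewrite -Nq -big_split; apply: eq_bigr => t _; rewrite mulrDr.
Qed.

End Expectation.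

(** * The sequential sampling distribution *)

Section Kraft.
Variables (R : realType) (n : nat) (A : 'I_n -> choiceType).
Variable S : {fset {dffun forall i : 'I_n, A i}}.
Variable pi : 'S_n.
Implicit Types s x y : {dffun forall i : 'I_n, A i}.

(** The parameter is the number k of revealed components rather than an index:
    [agreeing S i s pi] is the case k = pi^-1 i, while k = 0 gives S and k = n
    gives the singleton of s, the two ends of the induction below. *)
Definition same_prefix k s : {fset {dffun forall i : 'I_n, A i}} :=
  [fset x in S | [forall j : 'I_n, ((pi^-1)%g j < k)%N ==> (x j == s j)]].

Lemma same_prefixP k s x :
  reflect (x \in S /\ forall j : 'I_n, ((pi^-1)%g j < k)%N -> x j = s j)
          (x \in same_prefix k s).
Proof.
rewrite !inE; apply: (iffP andP) => -[xS eqx]; split=> //.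
  by move=> j jk; apply/eqP; move/forallP/(_ j)/implyP: eqx; apply.
by apply/forallP => j; apply/implyP => jk; rewrite eqx.
Qed.

Lemma same_prefix_eq k s x :
  x \in same_prefix k s -> same_prefix k x = same_prefix k s.
Proof.
move=> /same_prefixP[_ xs]; apply/fsetP => y.
by apply/same_prefixP/same_prefixP => -[yS yx]; split=> // j jk;
  rewrite yx // xs.
Qed.

Lemma same_prefix0 s : same_prefix 0 s = S.
Proof. by apply/fsetP => x; apply/same_prefixP/idP => [[]|]. Qed.

Lemma same_prefix_full s : s \in S -> same_prefix n s = [fset s].
Proof.
move=> sS; apply/fsetP => x; rewrite inE.
apply/same_prefixP/eqP => [[_ xs]|->//].
by apply/ffunP => j; apply: xs.
Qed.

Lemma nvalues_gt0 i s : s \in S -> (0 < nvalues S i s pi)%N.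
Proof.
move=> sS; rewrite cardfs_gt0; apply/fset0Pn; exists (s i).
by apply: in_imfset; apply/same_prefixP.
Qed.

Lemma same_prefixS (k : 'I_n) y :
  same_prefix k.+1 y = [fset x in same_prefix k y | x (pi k) == y (pi k)].
Proof.
apply/fsetP => x; rewrite [RHS]in_fset /=.
apply/same_prefixP/andP => [[xS xy]|[/same_prefixP[xS xy] /eqP xk]].
  split; last by apply/eqP/xy; rewrite permK.
  by apply/same_prefixP; split=> // j jk; apply/xy/ltnW.
split=> // j; rewrite ltnS leq_eqVlt => /orP[/eqP/val_inj jk|/xy//].
by rewrite -[j](permKV pi) jk.
Qed.

(** Kraft's equality, conditionally on the first k revealed components: the
    remaining factors of q are the probabilities of the continuations of s.
    Splitting these according to the value of the next component gives
    X_(pi k) classes, each of conditional mass 1 by the statement for k + 1,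
    and each weighted by the same factor 1 / X_(pi k), because X_(pi k) only
    depends on the first k revealed components. *)
Lemma kraft_prefix k s : (k <= n)%N -> s \in S ->
  \sum_(x <- same_prefix k s)
     \prod_(j | (k <= (pi^-1)%g j)%N) (nvalues S j x pi)%:R^-1 = 1 :> R.
Proof.
move=> kn; have [d] : {d | n - k = d}%N by exists (n - k)%N.
elim: d => [|d IH] in k kn s * => nk sS.
  have -> : k = n by apply/eqP; rewrite eqn_leq kn -subn_eq0 nk.
  rewrite same_prefix_full // big_seq_fset1 big_pred0 // => j.
  by rewrite leqNgt ltn_ord.
have kn' : (k < n)%N by rewrite -subn_gt0 nk.
pose i := pi (Ordinal kn').
have pi_i : (pi^-1)%g i = k :> nat by rewrite permK.
have agreeingE x : agreeing S i x pi = same_prefix k x.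
  by rewrite /agreeing pi_i.
set N := (nvalues S i s pi)%:R : R.
have N0 : N != 0 by rewrite pnatr_eq0 -lt0n nvalues_gt0.
have step x : x \in same_prefix k s ->
    \prod_(j | (k <= (pi^-1)%g j)%N) (nvalues S j x pi)%:R^-1 =
    N^-1 * \prod_(j | (k < (pi^-1)%g j)%N) (nvalues S j x pi)%:R^-1.
  move=> xs; rewrite (bigD1 i) ?pi_i //=; congr (_ * _).
    by rewrite /N /nvalues !agreeingE (same_prefix_eq xs).
  apply: eq_bigl => j; rewrite [RHS]ltn_neqAle andbC; congr (_ && _).
  rewrite -(inj_eq (@perm_inj _ (pi^-1)%g)) -(inj_eq val_inj) /= pi_i.
  by rewrite eq_sym.
rewrite (eq_big_seq _ step) -mulr_sumr.
rewrite (partition_big_imfset _ (fun x : {dffun forall i, A i} => x i)) /=.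
rewrite (_ : \big[_/_]_(v <- _) _ = N) ?mulVf //.
transitivity (\sum_(v <- [fset (x : {dffun forall i, A i}) i
                             | x in same_prefix k s]) (1 : R)).
  apply: eq_big_seq => v /imfsetP[/= y ys ->].
  have yS : y \in S by case/same_prefixP: ys.
  rewrite big_fset_condE -(same_prefix_eq ys).
  rewrite -(same_prefixS (Ordinal kn')).
  by apply: IH; rewrite // subnS nk.
by rewrite big_const_seq count_predT iter_addr_0 /N /nvalues agreeingE.
Qed.

Lemma kraft_nvalues s : s \in S ->
  \sum_(x : S) \prod_(j < n) (nvalues S j (val x) pi)%:R^-1 = 1 :> R.
Proof.
move=> sS; have := kraft_prefix (leq0n n) sS.
by rewrite same_prefix0 big_seq_fsetE.
Qed.

Lemma ln_card_le_expect s : s \in S ->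
  ln (#|` S|%:R : R) <=
  expect (@uniform R S)
    (fun x : S => \sum_(i < n) ln (nvalues S i (val x) pi)%:R).
Proof.
move=> sS; rewrite cardfE.
have X0 (x : S) i : 0 < (nvalues S i (val x) pi)%:R :> R.
  by rewrite ltr0n nvalues_gt0 // fsvalP.
pose q (x : S) : R := \prod_(i < n) (nvalues S i (val x) pi)%:R^-1.
have q0 (x : S) : 0 < q x by apply: prodr_gt0 => i _; rewrite invr_gt0.
have q1 : \sum_(x : S) q x <= 1 by rewrite (kraft_nvalues sS).
apply: le_trans (gibbs_uniform [` sS] q0 q1) _.
by apply: ler_sum => x _; rewrite ln_prodV.
Qed.

End Kraft.

Theorem lemma4 (R : realType) (n : nat) (A : 'I_n -> choiceType)
    (S : {fset {dffun forall i : 'I_n, A i}}) (S_neq0 : S != fset0) :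
  (forall pi : 'S_n,
     ln (#|` S|%:R : R) <=
     expect (@uniform R S)
       (fun s : S => \sum_(i < n) ln (nvalues S i (val s) pi)%:R))
  /\
  (forall p : 'S_n -> R, is_distr p ->
     ln (#|` S|%:R : R) <=
     expect (indep (@uniform R S) p)
       (fun z : S * 'S_n => \sum_(i < n) ln (nvalues S i (val z.1) z.2)%:R)
     <= \sum_(i < n) maxval (fun s : S =>
          expect p (fun pi => ln (nvalues S i (val s) pi)%:R))).
Proof.
have /fset0Pn[s sS] := S_neq0.
have fixed_order pi := @ln_card_le_expect R n A S pi s sS.
split=> [//|p pd].
rewrite (expect_indep _ _
  (fun (x : S) pi => \sum_(i < n) ln (nvalues S i (val x) pi)%:R)).
apply/andP; split.
  rewrite expect_exchange -[leLHS](expect_cst _ pd).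
  exact: ler_expect.
under [leLHS]eq_bigr do rewrite expect_sum.
rewrite [leLHS]expect_sum; apply: ler_sum => i _.
exact/ler_expect_maxval/(uniform_distr R [` sS]).
Qed.
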